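(* For every integer $n\ge 0$, the probabilistic Hermite polynomial $H_n^e(x)$ satisfies $$e^{-\frac{D^{2}}{2}}\,(e^{-1}+x)^{n}=e^{\left(\mathbb{D}_{\mathrm H}-n-\frac{D}{1-e}\right)}\,H_{n}^e(x),$$ where $D=\frac{d}{dx}$ and $\mathbb{D}_{\mathrm H}=xD-D^{2}$.
   Context: Operators act on the vector space of real polynomials in one variable $x$. $D=\frac{d}{dx}$, and $x$ also denotes the operator of multiplication by $x$. The symbol $e$ is Euler's number. The probabilistic Hermite polynomials are $H_n^e(x)=e^{-D^2/2}x^n$, the superscript $e$ in $H_n^e$ being only part of the notation. The Hermite differential operator is $\mathbb{D}_{\mathrm H}=xD-D^2$, and $\mathbb{D}_{\mathrm H}H_n^e=nH_n^e$. Scalars such as $n$ denote the corresponding multiple of the identity operator. For an operator $T$ on polynomials, $e^{T}=\sum_{k\ge0}T^k/k!$. The operators exponentiated here do not raise degree, so they preserve each finite-dimensional space of polynomials of degree at most $N$, and the series is taken there. *)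

(* Defs.v *)
From mathcomp Require Import all_boot all_order all_algebra.
From mathcomp Require Import all_classical all_reals all_analysis.

Set Implicit Arguments.
Unset Strict Implicit.
Unset Printing Implicit Defensive.

Import Order.TTheory GRing.Theory Num.Theory.
Import numFieldNormedType.Exports.
Local Open Scope ring_scope.

(* The term of index [k] of the series $e^T p = \sum_k T^k p / k!$. *)
Definition opexp_coeff (R : realType) (T : {poly R} -> {poly R})
    (p : {poly R}) (k : nat) : {poly R} :=
  (k`!%:R)^-1 *: iter k T p.

(* $e^T p$ for an operator [T] that does not raise degree.  All the terms of
   the series then lie in the finite-dimensional space of polynomials of
   [size] at most [size p], where convergence is convergence of each
   coefficient; [opexp_cvg] below shows that the limits exist. *)
Definition opexp (R : realType) (T : {poly R} -> {poly R}) (p : {poly R}) :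
    {poly R} :=
  \poly_(i < size p) limn (series (fun k => (opexp_coeff T p k)`_i)).

Definition hermite_op (R : realType) : {poly R} -> {poly R} :=
  ('X \*o deriv) \- (deriv \o deriv).

Definition hermite_poly (R : realType) (n : nat) : {poly R} :=
  opexp ((- 2^-1) \*: (deriv \o deriv)) 'X^n.

Section OpexpConvergence.
Context {R : realType} (T : {linear {poly R} -> {poly R}}).
Hypothesis size_T : forall p, (size (T p) <= size p)%N.

Let size_iterT k p : (size (iter k T p) <= size p)%N.
Proof. by elim: k => //= k; apply: leq_trans. Qed.

Let nrm N (p : {poly R}) : R := \sum_(i < N) `|p`_i|.

Let C N : R := \sum_(i < N) nrm N (T 'X^i).

Let nrm_T N (p : {poly R}) : (size p <= N)%N -> nrm N (T p) <= C N * nrm N p.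
Proof.
move=> sp.
have -> : T p = \sum_(j < N) p`_j *: T 'X^j.
  rewrite -[in LHS](coefK p) (poly_def (size p)) linear_sum /=.
  rewrite (big_ord_widen N (fun j => T (p`_j *: 'X^j)) sp) big_mkcond /=.
  apply: eq_bigr => j _; rewrite linearZ /=.
  by case: ltnP => // /(nth_default 0) ->; rewrite scale0r.
rewrite /nrm /C mulr_suml.
apply: (@le_trans _ _ (\sum_(i < N) \sum_(j < N) `|p`_j| * `|(T 'X^j)`_i|)).
  apply: ler_sum => i _; rewrite coef_sum (le_trans (ler_norm_sum _ _ _)) //.
  by apply: ler_sum => j _; rewrite coefZ normrM.
rewrite exchange_big /=; apply: ler_sum => j _.
rewrite -mulr_sumr mulrC ler_wpM2l ?sumr_ge0 //.
by rewrite (bigD1 j) //= lerDl sumr_ge0.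
Qed.

Let nrm_iterT N k (p : {poly R}) :
  (size p <= N)%N -> nrm N (iter k T p) <= C N ^+ k * nrm N p.
Proof.
move=> sp; elim: k => [|k IHk]; first by rewrite expr0 mul1r.
rewrite iterS (le_trans (nrm_T _)) ?(leq_trans (size_iterT _ _)) //.
rewrite exprS -mulrA ler_wpM2l //.
by apply: sumr_ge0 => i _; apply: sumr_ge0.
Qed.

Lemma is_cvg_opexp (p : {poly R}) (i : nat) :
  cvgn (series (fun k => (opexp_coeff T p k)`_i)).
Proof.
have [ip|pi] := ltnP i (size p); last first.
  have -> : (fun k => (opexp_coeff T p k)`_i) = (fun=> 0 : R).
    by apply/funext => k; rewrite /opexp_coeff coefZ nth_default ?mulr0 ?(leq_trans (size_iterT _ _)).
  have -> : series (fun=> 0 : R) = (fun=> 0 : R).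
    by apply/funext => k; rewrite /series /= big1.
  exact: is_cvg_cst.
apply: normed_cvg; set N := size p.
apply: (@series_le_cvg _ _ (nrm N p *: exp_coeff (C N))).
- by move=> k /=.
- move=> k; rewrite /exp_coeff /= mulr_ge0 ?sumr_ge0 //.
  rewrite divr_ge0 // exprn_ge0 //.
  by apply: sumr_ge0 => j _; apply: sumr_ge0.
- move=> k; rewrite /= /opexp_coeff coefZ normrM ger0_norm ?invr_ge0 //.
  rewrite /exp_coeff /= [leRHS]mulrA [leRHS]mulrC ler_wpM2l ?invr_ge0 //.
  rewrite mulrC; apply: le_trans (nrm_iterT k (leqnn _)).
  by rewrite /nrm (bigD1 (Ordinal ip)) //= lerDl sumr_ge0.
- exact/is_cvg_seriesZ/is_cvg_series_exp_coeff.
Qed.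

Local Open Scope classical_set_scope.

Lemma opexp_cvg (p : {poly R}) (i : nat) :
  (\sum_(0 <= k < n) opexp_coeff T p k)`_i @[n --> \oo] --> (opexp T p)`_i.
Proof.
have -> : (fun n => (\sum_(0 <= k < n) opexp_coeff T p k)`_i) =
          series (fun k => (opexp_coeff T p k)`_i).
  by apply/funext => n; rewrite coef_sum.
rewrite coef_poly; case: ltnP => [_|pi]; first exact: is_cvg_opexp.
have -> : series (fun k => (opexp_coeff T p k)`_i) = (fun=> 0 : R).
  apply/funext => n; rewrite /series /= big1 // => k _.
  by rewrite /opexp_coeff coefZ nth_default ?mulr0 ?(leq_trans (size_iterT _ _)).
exact: cvg_cst.
Qed.

End OpexpConvergence.

(* Main.v *)
Require Import Defs.
From HB Require Import structures.
From mathcomp Require Import all_boot all_order all_algebra.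
From mathcomp Require Import all_classical all_reals all_analysis.
From mathcomp Require Import ring.

Import Order.TTheory GRing.Theory Num.Theory.
Import numFieldNormedType.Exports.
Local Open Scope ring_scope.

(** Write $A = e^{-D^2/2}$, $e$ for Euler's number and $b = 1/(1-e)$.
    Conjugation by $A$ fixes $D$ and turns multiplication by $x$ into $x - D$
    ([heat_mulX]), so it turns $xD$ into the Hermite operator $xD - D^2$
    ([hermite_heat]).  Hence the operator exponentiated on the right of the
    identity is $A ((x-b)D - n) A^{-1}$, and since $H_n = A x^n$ the claim is
    $A$ applied to
    $$ (e^{-1} + x)^n = e^{(x-b)D - n} x^n. $$
    The operator $(x-b)D$ generates the dilations about $b$, so the right-hand
    side is $e^{-n} (b + e(x-b))^n$, and $e^{-1}b - b = e^{-1}$ by the choice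
    of $b$.

    To avoid composing exponentials of non-commuting operators, the dilation
    is read on an eigenbasis: $(x-b)^j$ is an eigenvector of $(x-b)D - n$ with
    eigenvalue $j - n$, so $A (x-b)^j$ is one of the conjugated operator
    ([hermite_shift_eigen]).  As the exponential of an operator is linear
    ([opexp_linear]) and acts on an eigenvector through the exponential of the
    eigenvalue ([opexp_eigen]), it remains to expand $x^n$ and
    $(e^{-1} + x)^n$ in powers of $x - b$ and to compare coefficients.  The
    commutation rules of $A$ come from its formula as a finite sum
    ([heatE]). *)

HB.instance Definition _ (R : realType) :=
  GRing.Linear.copy (@hermite_op R) (('X \*o deriv) \- (deriv \o deriv)).

Lemma leq_size_deriv {S : nzSemiRingType} (p : {poly S}) :
  (size p^`() <= size p)%N.
Proof. by have [->|/lt_size_deriv/ltnW//] := eqVneq p 0; rewrite deriv0. Qed.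

Section OpexpTheory.
Context {R : realType} {T : {linear {poly R} -> {poly R}}}.
Hypothesis size_T : forall p, (size (T p) <= size p)%N.
Local Open Scope classical_set_scope.

(** Every property of [opexp] below is proved by exhibiting the coefficientwise
    limit of the partial sums, which avoids any case analysis on the truncation
    at [size p] in the definition of [opexp]. *)
Lemma opexp_unique (p q : {poly R}) :
  (forall i, (\sum_(0 <= k < n) opexp_coeff T p k)`_i @[n --> \oo] --> q`_i) ->
  opexp T p = q.
Proof.
move=> cv; apply/polyP => i.
have cvT := opexp_cvg size_T (p := p) (i := i).
by apply: (cvg_unique _ cvT (cv i)); exact: norm_hausdorff.
Qed.

Lemma opexp_linear : linear (opexp T).
Proof.
move=> a p q; apply: opexp_unique => i; rewrite coefD coefZ.
have coeffE k : opexp_coeff T (a *: p + q) k =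
    a *: opexp_coeff T p k + opexp_coeff T q k.
  rewrite /opexp_coeff.
  have -> : iter k T (a *: p + q) = a *: iter k T p + iter k T q.
    by elim: k => //= k ->; rewrite linearP.
  by rewrite scalerDr !scalerA mulrC.
under eq_cvg do
  rewrite (eq_bigr _ (fun k _ => coeffE k)) big_split -scaler_sumr coefD coefZ.
by apply: cvgD; [apply: cvgMl_tmp|]; exact: opexp_cvg.
Qed.

Lemma opexp_sum m (a : 'I_m -> R) (v : 'I_m -> {poly R}) :
  opexp T (\sum_(j < m) a j *: v j) = \sum_(j < m) a j *: opexp T (v j).
Proof.
elim/big_rec2: _ => [|j y q _ <-]; last exact: opexp_linear.
by rewrite /opexp size_poly0 poly_def big_ord0.
Qed.

Lemma opexp_eigen l (v : {poly R}) : T v = l *: v -> opexp T v = expR l *: v.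
Proof.
move=> Tv; apply: opexp_unique => i; rewrite coefZ.
rewrite (_ : (fun n => _) = (fun n => series (exp_coeff l) n * v`_i)).
  by apply: cvgMr_tmp; exact: is_cvg_series_exp_coeff.
apply/funext => n; rewrite coef_sum /series /= mulr_suml.
apply: eq_bigr => k _; rewrite /opexp_coeff.
have -> : iter k T v = l ^+ k *: v.
  elim: k => [|k IH]; first by rewrite expr0 scale1r.
  by rewrite iterS IH linearZ /= Tv scalerA exprSr.
by rewrite /exp_coeff /= scalerA coefZ [_^-1 * _]mulrC.
Qed.

Lemma opexp_nilpotent N (p : {poly R}) :
  iter N T p = 0 -> opexp T p = \sum_(k < N) opexp_coeff T p k.
Proof.
move=> TN0; apply: opexp_unique => i; apply: cvg_near_cst.
near=> n; have leNn : (N <= n)%N by near: n; exact: nbhs_infty_ge.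
rewrite (big_cat_nat (leq0n N) leNn) //= big_mkord.
rewrite [X in _ + X]big_nat [X in _ + X]big1 ?addr0 //.
move=> k /andP[leNk _]; rewrite /opexp_coeff -(subnK leNk) iterD TN0.
rewrite (_ : iter _ T 0 = 0) ?scaler0 //.
by elim: (k - N)%N => //= m ->; exact: linear0.
Unshelve. all: by end_near.
Qed.

End OpexpTheory.

Section Heat.
Context {R : realType}.
Implicit Types p : {poly R}.

Lemma size_half_deriv2 p :
  (size (((- 2^-1 : R) \*: (deriv \o deriv)) p) <= size p)%N.
Proof.
rewrite /=; apply: (leq_trans (size_scale_leq _ _)).
exact: leq_trans (leq_size_deriv _) (leq_size_deriv _).
Qed.

(** The operator $e^{-D^2/2}$, which is the heat semigroup run backwards; it
    maps $x^n$ to the Hermite polynomial of degree $n$. *)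
Definition heat : {poly R} -> {poly R} :=
  opexp ((- 2^-1 : R) \*: (deriv \o deriv)).

HB.instance Definition _ :=
  GRing.isLinear.Build R {poly R} {poly R} *:%R heat
    (opexp_linear size_half_deriv2).

(** $D^2$ is nilpotent on polynomials of bounded degree.  The bound [N] is left
    free so that polynomials of different sizes can be summed over the same
    range. *)
Lemma heatE N p : (size p <= N)%N ->
  heat p = \sum_(k < N) (k`!%:R^-1 * (- 2^-1) ^+ k) *: p^`(k.*2).
Proof.
have itE k : iter k ((- 2^-1 : R) \*: (deriv \o deriv)) p =
    (- 2^-1) ^+ k *: p^`(k.*2).
  elim: k => [|k IHk]; first by rewrite expr0 scale1r.
  by rewrite iterS IHk /= !derivZ scalerA exprS -!derivnS.
move=> leN; rewrite /heat (opexp_nilpotent size_half_deriv2 N); last first.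
  by rewrite itE derivn_poly0 ?scaler0 // -addnn (leq_trans leN) ?leq_addr.
by apply: eq_bigr => k _; rewrite /opexp_coeff itE scalerA.
Qed.

Lemma deriv_heat p : (heat p)^`() = heat p^`().
Proof.
rewrite (@heatE (size p) p) // (@heatE (size p) p^`());
  last exact: leq_size_deriv.
rewrite raddf_sum.
by apply: eq_bigr => k _; rewrite /= derivZ -derivnS -derivSn.
Qed.

(** By Leibniz, $D^{2k}(xp) = x D^{2k}p + 2k D^{2k-1}p$.  The first terms sum
    to $x$ times the image of $p$; in the second ones,
    $\frac{(-1/2)^k}{k!} 2k = - \frac{(-1/2)^{k-1}}{(k-1)!}$ shifts the index
    by one and leaves minus the image of $Dp$. *)
Lemma heat_mulX p : heat ('X * p) = 'X * heat p - (heat p)^`().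
Proof.
set N := size p.
have szX : (size ('X * p)%R <= N.+1)%N.
  by rewrite (leq_trans (size_polyMleq _ _)) // size_polyX.
(* The shift of the index consumes one term, hence the different ranges. *)
rewrite deriv_heat (@heatE N.+1 p) // (@heatE N p^`());
  last exact: leq_size_deriv.
rewrite (heatE _ _ szX) !big_ord_recl mulrDr -addrA; congr (_ + _).
  by rewrite !derivn0 scalerAr.
rewrite mulr_sumr -sumrB; apply: eq_bigr => k _.
have := derivnMXaddC (k.*2).+1 p 0; rewrite addr0 mulrC /= => dX.
rewrite !add0n /bump leq0n add1n dX scalerDr addrC -scalerAr [_ * 'X]mulrC.
congr (_ + _); rewrite -derivnS derivSn -scaleNr.
rewrite -[_ *+ k.*2.+2]scaler_nat scalerA; congr (_ *: _).
rewrite factS natrM exprS.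
have -> : (k.*2.+2)%:R = 2 * (k.+1)%:R :> R by rewrite -natrM mul2n.
by field; rewrite nat1r !pnatr_eq0 -lt0n fact_gt0.
Qed.

(** The Hermite operator is $(x - D)D$, and $x - D$ is the conjugate of $x$. *)
Lemma hermite_heat p : hermite_op (heat p) = heat ('X * p^`()).
Proof. by rewrite heat_mulX -!deriv_heat. Qed.

End Heat.

Lemma size_hermite_shift (R : realType) (a b : R) (p : {poly R}) :
  (size (((@hermite_op R \- a \*: idfun) \- b \*: deriv) p) <= size p)%N.
Proof.
have [->|p0] := eqVneq p 0; first by rewrite linear0.
have ltp := lt_size_deriv p0.
have szX : (size ('X * p^`())%R <= size p)%N.
  by rewrite (leq_trans (size_polyMleq _ _)) // size_polyX.
have szB (q r : {poly R}) : (size q <= size p)%N -> (size r <= size p)%N ->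
    (size (q - r)%R <= size p)%N.
  by move=> sq sr; rewrite (leq_trans (size_polyD _ _)) // size_polyN geq_max sq.
apply: (szB); last by rewrite (leq_trans (size_scale_leq _ _)) // ltnW.
apply: (szB); last exact: size_scale_leq.
by apply: (szB) => //; rewrite (leq_trans (leq_size_deriv _)) // ltnW.
Qed.

(** The operator is the conjugate of $(x-b)D - a$, for which $(x-b)^j$ is an
    eigenvector. *)
Lemma hermite_shift_eigen (R : realType) (a b : R) j :
  ((@hermite_op R \- a \*: idfun) \- b \*: deriv) (heat (('X - b%:P) ^+ j)) =
  (j%:R - a) *: heat (('X - b%:P) ^+ j).
Proof.
rewrite /= hermite_heat deriv_heat -!linearZ -!linearB /=; congr heat.
rewrite addrAC derivZ -mul_polyC -mulrBl scalerBl; congr (_ - _).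
case: j => [|j]; first by rewrite expr0 derivC mulr0 scale0r.
by rewrite deriv_exp derivXsubC mul1r mulrnAr -exprS scaler_nat.
Qed.

Theorem proposition2 (R : realType) (n : nat) :
  opexp ((- 2^-1) \*: (deriv \o deriv))
        (((expR 1)^-1%:P + 'X) ^+ n : {poly R}) =
  opexp ((@hermite_op R \- n%:R \*: idfun) \- (1 - expR 1)^-1 \*: deriv)
        (hermite_poly R n).
Proof.
set b := (1 - expR 1)^-1.
rewrite /hermite_poly -/heat.
have -> : 'X^n = \sum_(j < n.+1) (b ^+ (n - j) *+ 'C(n, j)) *: ('X - b%:P) ^+ j.
  rewrite -[in LHS](subrKC b%:P 'X) exprDn.
  apply: eq_bigr => j _.
  by rewrite -polyC_exp mul_polyC scalerMnl.
rewrite linear_sum /=; under eq_bigr do rewrite linearZ /=.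
(* Apply the exponential on the right to the eigenbasis expansion of
   [heat 'X^n], then pull [heat] out of both sides. *)
rewrite (opexp_sum (size_hermite_shift _ _ _)).
under eq_bigr do
  rewrite (opexp_eigen (size_hermite_shift _ _ _) _ _
    (hermite_shift_eigen _ _ _ _)).
under eq_bigr do rewrite scalerA -linearZ /=.
rewrite -linear_sum /=; congr heat.
have e1 : 1 - expR 1 != 0 :> R by rewrite subr_eq0 lt_eqF // expR_gt1.
(* The only place where the value of [b] matters. *)
have -> : (expR 1)^-1%:P + 'X =
    ((expR 1)^-1 * b)%:P + ('X - b%:P) :> {poly R}.
  rewrite addrCA -polyCN -polyCD [LHS]addrC; congr (_ + _%:P).
  by rewrite /b; field; rewrite e1 gt_eqF ?expR_gt0.
rewrite exprDn; apply: eq_bigr => j _.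
have lejn : (j <= n)%N by rewrite -ltnS.
rewrite -polyC_exp mul_polyC scalerMnl; congr (_ *: _).
rewrite exprMn mulrnAl mulrC; congr (_ * _ *+ _).
by rewrite -opprB expRN -natrB // -[(n - j)%:R]mulr1 expRM_natl exprVn.
Qed.
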